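(* There is a positive integer constant $c$ such that the following holds. Let $n, D$ be positive integers and let $f\in\mathbb{R}[x_1,\dots,x_n]$ have degree at most $D$ in each variable. Then the sentence \[\Phi = (\exists x_1,\dots,x_n)\ f(x_1,\dots,x_n)=0\] is true if and only if the sentence \[\Psi = (\forall z>0)(\exists y\in(0,z))(\exists x_1,\dots,x_n)\ \Big(|f(x_1,\dots,x_n)|<y^C\Big)\wedge\bigwedge_{j=1}^n\Big(|y x_j|<1\Big)\] is true, where $C = nD^{n^c}+(D+1)n$ and all variables range over $\mathbb{R}$. *)

(* Defs.v *)
From mathcomp Require Import all_boot all_order all_algebra.
From mathcomp Require mpoly.
Set Implicit Arguments.
Unset Strict Implicit.
Unset Printing Implicit Defensive.

(* mpoly is imported only inside this section, because its notations clash
   with those of mathcomp-analysis. *)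
Section DegreeInEachVariable.
Import mpoly.

Definition mdeg_each_le (R : nzRingType) (n D : nat) (f : {mpoly R[n]}) :=
  forall m : 'X_{1..n}, m \in msupp f -> forall i : 'I_n, m i <= D.

End DegreeInEachVariable.

(* Main.v *)
Require Import Defs.
From mathcomp Require Import all_boot all_order all_algebra reals.
From mathcomp Require Import polyXY polyrcf ring lra zify.
From mathcomp Require mpoly.
Set Implicit Arguments.
Unset Strict Implicit.
Unset Printing Implicit Defensive.
Import Order.TTheory GRing.Theory Num.Theory.
Local Open Scope ring_scope.

(** If [f] has no real zero, put [q = f ^ 2] and, for [d > 0], minimise
    [q + d * (x_1 ^ (e + 1) + ... + x_n ^ (e + 1))] with [e] odd and larger
    than the degree of [q]. At a minimiser the gradient vanishes, so each
    [x_i ^ e] is a combination of monomials of smaller degree and, over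
    [R[d, 1/d]], all monomials lie in the span of the [N = e ^ n] monomials
    with exponents below [e]. Hence the minimum, divided by [d], is a root [t]
    of a nonzero polynomial [P(d, t)] of degree at most [N] in [t].
    Compactness forces [t] to infinity as [d] tends to [0], and then [P] forces
    [1 <= K * d * t ^ N]. A point with [|x_j| < 1 / y] and [|f x| < y ^ C]
    bounds [t] by [(n + 1) / y ^ (e + 1)] when [d = y ^ ((e + 1) * N + 1)], which is a
    contradiction for small [y]. Since [C] is too small for this argument when
    [D = 1] or [n = 1], these cases are separate: [f] is then constant,
    respectively bounded away from [0]. *)

(** * Polynomial functions as lists of terms *)

Section PolynomialFunctions.
Variables (R : realFieldType) (n : nat).
Implicit Types (x : 'I_n -> R) (m : {ffun 'I_n -> nat}).
Implicit Types (s : seq (R * {ffun 'I_n -> nat})).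

Definition mono m x : R := \prod_i x i ^+ m i.
Definition totdeg m : nat := \sum_i m i.
Definition addexp m1 m2 : {ffun 'I_n -> nat} := [ffun j => m1 j + m2 j]%N.
Definition subexp m (i : 'I_n) k : {ffun 'I_n -> nat} :=
  [ffun j => m j - (j == i) * k]%N.

(** Exponents may repeat in [s], so that [psquare] need not collect like terms. *)
Definition peval s x : R := \sum_(u <- s) u.1 * mono u.2 x.
(** If [u.2 i = 0], the subtraction in [subexp] is truncated, but the factor [(u.2 i)%:R] kills the
    term. *)
Definition pderiv s i x : R :=
  \sum_(u <- s) u.1 * (u.2 i)%:R * mono (subexp u.2 i 1) x.
Definition psquare s : seq (R * {ffun 'I_n -> nat}) :=
  [seq (u.1 * v.1, addexp u.2 v.2) | u <- s, v <- s].

Definition update x i (t : R) : 'I_n -> R := fun j => if j == i then t else x j.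
Definition line_poly s x i : {poly R} :=
  \sum_(u <- s) (u.1 * \prod_(j | j != i) x j ^+ u.2 j) *: 'X^(u.2 i).

Lemma mono_addexp m1 m2 x : mono (addexp m1 m2) x = mono m1 x * mono m2 x.
Proof.
by rewrite /mono -big_split; apply: eq_bigr => j _; rewrite ffunE exprD.
Qed.

Lemma totdeg_addexp m1 m2 : totdeg (addexp m1 m2) = (totdeg m1 + totdeg m2)%N.
Proof. by rewrite /totdeg -big_split; apply: eq_bigr => j _; rewrite ffunE. Qed.

Lemma totdeg_le m D : (forall i, m i <= D)%N -> (totdeg m <= n * D)%N.
Proof.
move=> mD; apply: (@leq_trans (\sum_(i < n) D)); first exact: leq_sum.
by rewrite sum_nat_const card_ord.
Qed.

Lemma totdeg_subexp_le m i k : (totdeg (subexp m i k) <= totdeg m)%N.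
Proof. by apply: leq_sum => j _; rewrite ffunE leq_subr. Qed.

Lemma subexp_addexp m i k : (k <= m i)%N ->
  m = addexp (subexp m i k) [ffun j => (j == i) * k]%N.
Proof.
move=> km; apply/ffunP => j; rewrite !ffunE.
by case: eqP => [->|_]; rewrite ?mul1n ?mul0n ?subn0 ?addn0 // subnK.
Qed.

Lemma totdeg_subexp m i k : (k <= m i)%N ->
  (totdeg (subexp m i k) + k = totdeg m)%N.
Proof.
move=> km; rewrite [in RHS](subexp_addexp km) totdeg_addexp; congr addn.
rewrite /totdeg (bigD1 i) //= ffunE eqxx mul1n big1 ?addn0 // => j /negPf ji.
by rewrite ffunE ji.
Qed.

Lemma mono_subexp m i k x : (k <= m i)%N ->
  mono m x = mono (subexp m i k) x * x i ^+ k.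
Proof.
move=> km; rewrite [in LHS](subexp_addexp km) mono_addexp; congr *%R.
rewrite /mono (bigD1 i) //= ffunE eqxx mul1n big1 ?mulr1 // => j /negPf ji.
by rewrite ffunE ji.
Qed.

Lemma eq_peval s x y : x =1 y -> peval s x = peval s y.
Proof.
move=> xy; apply: eq_bigr => u _; congr *%R; apply: eq_bigr => j _.
by rewrite xy.
Qed.

Lemma peval_square s x : peval (psquare s) x = peval s x ^+ 2.
Proof.
rewrite /peval /psquare big_allpairs_dep expr2 big_distrl.
apply: eq_bigr => u _.
rewrite big_distrr; apply: eq_bigr => v _ /=.
by rewrite mono_addexp mulrACA.
Qed.

Lemma totdeg_square s d : {in s, forall u, (totdeg u.2 <= d)%N} ->
  {in psquare s, forall u, (totdeg u.2 <= d + d)%N}.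
Proof.
move=> sd _ /allpairsP [[u v] /= [us vs ->]] /=.
by rewrite totdeg_addexp leq_add ?sd.
Qed.

Lemma mono_update m x i t :
  mono m (update x i t) = (\prod_(j | j != i) x j ^+ m j) * t ^+ m i.
Proof.
rewrite /mono (bigD1 i) //= /update eqxx mulrC; congr *%R.
by apply: eq_bigr => j /negPf ->.
Qed.

Lemma horner_line_poly s x i t :
  (line_poly s x i).[t] = peval s (update x i t).
Proof.
rewrite horner_sum; apply: eq_bigr => u _.
by rewrite hornerZ hornerXn mono_update mulrA.
Qed.

Lemma size_line_poly s x i D :
  {in s, forall u : R * {ffun 'I_n -> nat}, (u.2 i <= D)%N} ->
  (size (line_poly s x i) <= D.+1)%N.
Proof.
move=> sD; rewrite /line_poly big_seq.
elim/big_ind: _ => [|p q pD qD|u us]; first by rewrite size_poly0.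
  by rewrite (leq_trans (size_polyD _ _)) // geq_max pD.
by rewrite (leq_trans (size_scale_leq _ _)) // size_polyXn ltnS sD.
Qed.

Lemma horner_deriv_line_poly s x i :
  (line_poly s x i)^`().[x i] = pderiv s i x.
Proof.
rewrite raddf_sum horner_sum; apply: eq_bigr => u _.
rewrite /= derivZ derivXn hornerZ hornerMn hornerXn /mono.
rewrite [X in _ = _ * X](bigD1 i) //= ffunE eqxx.
rewrite mul1n subn1 -[in LHS](mulr_natl _ (u.2 i)).
rewrite [in RHS](eq_bigr (fun j => x j ^+ u.2 j)) => [|j /negPf ji].
  by ring.
by rewrite ffunE ji mul0n subn0.
Qed.

End PolynomialFunctions.

(* [mpoly] can only be imported before the notations of mathcomp-analysis. *)
Section CoefficientList.
Import mpoly.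

Lemma meval_peval (R : realFieldType) n D (f : {mpoly R[n]}) :
  mdeg_each_le D f ->
  exists2 s : seq (R * {ffun 'I_n -> nat}),
    {in s, forall (u : R * {ffun 'I_n -> nat}), forall i, (u.2 i <= D)%N} &
    forall x, meval x f = peval s x.
Proof.
move=> fD; exists [seq (mcoeff m f, [ffun i => m i]) | m <- msupp f].
  by move=> u /mapP [m mf ->] i; rewrite ffunE; exact: fD.
move=> x; rewrite mevalE [RHS]big_map; apply: eq_bigr => m _; congr *%R.
by apply: eq_bigr => i _; rewrite ffunE.
Qed.

End CoefficientList.

(** * Algebraic elimination at critical points *)

Section CriticalPoints.
Variables (R : realFieldType) (n e : nat) (s : seq (R * {ffun 'I_n -> nat})).
Implicit Types (x : 'I_n -> R) (d : R) (h : R -> ('I_n -> R) -> R).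

Definition perturbed d x : R := peval s x + d * \sum_i x i ^+ e.+1.

(** Vanishing of the gradient of [perturbed d], stated without analysis so that the elimination
    works over any real field. *)
Definition critical d x : Prop :=
  forall i, e.+1%:R * d * x i ^+ e = - pderiv s i x.

Definition box_exp (b : {ffun 'I_n -> 'I_e}) : {ffun 'I_n -> nat} :=
  [ffun j => b j : nat].

(** The coefficients [a b] are chosen before [d] and [x], so that one matrix over [{poly R}] serves
    all critical points; [d ^+ k] clears denominators. *)
Definition reducible_with k h : Prop :=
  exists a : {ffun 'I_n -> 'I_e} -> {poly R}, forall d x, critical d x ->
    d ^+ k * h d x = \sum_b (a b).[d] * mono (box_exp b) x.

(* On critical points, [h] lies in the span of the monomials with exponents
   below [e], with coefficients in [R[d, d^-1]]. *)
Definition reducible h : Prop := exists k, reducible_with k h.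

Lemma reducible_with_leq k l h :
  (k <= l)%N -> reducible_with k h -> reducible_with l h.
Proof.
move=> kl [a ha]; exists (fun b => 'X^(l - k) * a b) => d x dx.
rewrite -(subnK kl) exprD -mulrA ha // mulr_sumr addnK.
by apply: eq_bigr => b _; rewrite hornerM hornerXn mulrA.
Qed.

Lemma eq_reducible h1 h2 : (forall d x, critical d x -> h1 d x = h2 d x) ->
  reducible h1 -> reducible h2.
Proof.
by move=> h12 [k [a ha]]; exists k, a => d x dx; rewrite -h12 // ha.
Qed.

Lemma reducible0 : reducible (fun _ _ => 0).
Proof.
exists 0, (fun=> 0) => d x _; rewrite mulr0 big1 // => b _.
by rewrite horner0 mul0r.
Qed.

Lemma reducibleD h1 h2 : reducible h1 -> reducible h2 ->
  reducible (fun d x => h1 d x + h2 d x).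
Proof.
move=> [k1 h1k] [k2 h2k]; exists (maxn k1 k2).
have [a ha] := reducible_with_leq (leq_maxl k1 k2) h1k.
have [b hb] := reducible_with_leq (leq_maxr k1 k2) h2k.
exists (fun c => a c + b c) => d x dx; rewrite mulrDr ha // hb // -big_split.
by apply: eq_bigr => c _; rewrite hornerD mulrDl.
Qed.

Lemma reducibleM (p : {poly R}) h : reducible h ->
  reducible (fun d x => p.[d] * h d x).
Proof.
move=> [k [a ha]]; exists k, (fun c => p * a c) => d x dx.
rewrite mulrCA ha // mulr_sumr; apply: eq_bigr => c _.
by rewrite hornerM mulrA.
Qed.

Lemma reducibleZ (c : R) h : reducible h -> reducible (fun d x => c * h d x).
Proof.
by move/(reducibleM c%:P); apply: eq_reducible => d x _; rewrite hornerC.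
Qed.

Lemma reducible_sum (I : eqType) (r : seq I) (h : I -> R -> ('I_n -> R) -> R) :
  {in r, forall i, reducible (h i)} ->
  reducible (fun d x => \sum_(i <- r) h i d x).
Proof.
elim: r => [_|i r IH hr].
  by apply: eq_reducible reducible0 => d x _; rewrite big_nil.
apply: (@eq_reducible (fun d x => h i d x + \sum_(j <- r) h j d x)).
  by move=> d x _; rewrite big_cons.
apply: reducibleD; first by apply: hr; rewrite mem_head.
by apply: IH => j jr; apply: hr; rewrite in_cons jr orbT.
Qed.

(** Division by [d] is absorbed by raising [k]. *)
Lemma reducible_cancel h : reducible (fun d x => d * h d x) -> reducible h.
Proof.
by move=> [k [a ha]]; exists k.+1, a => d x dx; rewrite exprSr -mulrA ha.
Qed.

Hypothesis deg_s : {in s, forall u, (totdeg u.2 < e)%N}.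

(* Criticality rewrites [x i ^+ e] into terms of smaller total degree. *)
Lemma reducible_mono m : reducible (fun _ => mono m).
Proof.
have [N] := ubnP (totdeg m); elim: N m => // N IH m mN.
case: (pickP (fun i => e <= m i)%N) => [i ei|m_lt]; last first.
  have me j : (m j < e)%N by rewrite ltnNge m_lt.
  pose b0 : {ffun 'I_n -> 'I_e} := [ffun j => Ordinal (me j)].
  exists 0, (fun b => (b == b0)%:R) => d x _.
  rewrite expr0 mul1r (bigD1 b0) //= eqxx big1 => [|b /negPf ->].
    rewrite addr0 hornerC mul1r; congr mono.
    by apply/ffunP => j; rewrite !ffunE.
  by rewrite horner0 mul0r.
(* Criticality determines [d * x i ^+ e] rather than [x i ^+ e] itself. *)
apply: reducible_cancel.
have e1 : e.+1%:R != 0 :> R by rewrite pnatr_eq0.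
pose h (u : R * {ffun 'I_n -> nat}) (_ : R) x :=
  mono (addexp (subexp m i e) (subexp u.2 i 1)) x.
pose c (u : R * {ffun 'I_n -> nat}) : R := - e.+1%:R^-1 * (u.1 * (u.2 i)%:R).
apply: (@eq_reducible (fun d x => \sum_(u <- s) c u * h u d x)) => [d x dx|].
  have -> : d * mono m x = mono (subexp m i e) x * (d * x i ^+ e).
    by rewrite (mono_subexp x ei) mulrCA.
  have -> : d * x i ^+ e = - (e.+1%:R^-1 * pderiv s i x).
    by rewrite -mulrN -dx -mulrA mulKf.
  rewrite mulrN -mulNr mulr_sumr mulr_sumr; apply: eq_bigr => u _.
  by rewrite /c /h mono_addexp; ring.
apply: reducible_sum => u us; apply: reducibleZ.
apply: IH; rewrite totdeg_addexp.
rewrite -ltnS (leq_trans _ mN) // ltnS -(totdeg_subexp ei) ltn_add2l.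
exact: leq_ltn_trans (totdeg_subexp_le u.2 i 1) (deg_s us).
Qed.

(** The product expands into monomials with coefficients in [R[d]], each reducible. Hence the span
    is stable under multiplication by [perturbed d]. *)
Lemma reducible_mono_perturbed m :
  reducible (fun d x => mono m x * perturbed d x).
Proof.
pose pow i : {ffun 'I_n -> nat} := [ffun j => (j == i) * e.+1]%N.
have powE i x : mono (pow i) x = x i ^+ e.+1.
  rewrite /mono (bigD1 i) //= ffunE eqxx mul1n big1 ?mulr1 // => j /negPf ji.
  by rewrite ffunE ji.
apply: (@eq_reducible (fun d x =>
    \sum_(u <- s) u.1 * mono (addexp m u.2) x
    + 'X.[d] * \sum_(i <- enum 'I_n) mono (addexp m (pow i)) x)) => [d x _|].
  rewrite /perturbed mulrDr; congr (_ + _).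
    rewrite [RHS]mulr_sumr; apply: eq_bigr => u _.
    by rewrite mono_addexp mulrCA.
  rewrite hornerX [RHS]mulrCA; congr *%R; rewrite mulr_sumr big_enum.
  by apply: eq_bigr => i _; rewrite mono_addexp powE.
apply: reducibleD.
  by apply: reducible_sum => u _; apply: reducibleZ; apply: reducible_mono.
by apply: reducibleM; apply: reducible_sum => i _; apply: reducible_mono.
Qed.

(* [d ^+ k * perturbed d x] is an eigenvalue of the matrix of multiplication
   by [d ^+ k * perturbed d] in the spanning monomials. *)
Lemma critical_value_algebraic : (0 < e)%N -> exists P : {poly {poly R}},
  [/\ P != 0, (size P <= (e ^ n).+1)%N &
      forall d x t, critical d x -> perturbed d x = d * t -> P.[t, d] = 0].
Proof.
move=> e_gt0; pose B := {ffun 'I_n -> 'I_e}.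
have cardB : #|B| = (e ^ n)%N by rewrite card_ffun !card_ord.
have /fin_all_exists [k hk] (b : B) :
    exists k, reducible_with k (fun d x => mono (box_exp b) x * perturbed d x).
  exact: reducible_mono_perturbed.
pose K := \max_b k b.
have /fin_all_exists [a ha] (b : B) := reducible_with_leq (leq_bigmax b) (hk b).
pose M := \matrix_(i < #|B|, j < #|B|) a (enum_val j) (enum_val i).
pose q := char_poly M.
(* [P] is [q] with its variable scaled by ['X^(K.+1)]: if [perturbed d x = d * t], the eigenvalue
   [d ^+ K * perturbed d x] equals [d ^+ K.+1 * t]. *)
pose P := \poly_(j < #|B|.+1) (q`_j * 'X^(K.+1 * j)).
have size_q : size q = #|B|.+1 by exact: size_char_poly.
exists P; split.
- apply/eqP => /(congr1 (fun p : {poly {poly R}} => p`_#|B|)).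
  rewrite coef_poly ltnSn coef0 => /eqP.
  have -> : q`_#|B| = 1.
    by have /monicP := char_poly_monic M; rewrite lead_coefE -/q size_q.
  by rewrite mul1r; apply/negP; rewrite monic_neq0 ?monicXn.
- by rewrite -cardB size_poly.
move=> d x t dx xt.
have -> : P.[t, d] = q.[t%:P * 'X^(K.+1)].[d].
  congr horner; rewrite horner_poly horner_coef size_q; apply: eq_bigr => j _.
  by rewrite exprMn -exprM -mulrA; congr *%R; rewrite mulrC.
rewrite -/(horner_eval d _) -horner_map /= map_char_poly.
apply/eqP; rewrite -/(root _ _) -eigenvalue_root_char.
apply/eigenvalueP; exists (\row_i mono (box_exp (enum_val i)) x).
  apply/rowP => j; rewrite !mxE.
  have -> : horner_eval d (t%:P * 'X^(K.+1)) = d ^+ K * perturbed d x.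
    rewrite /horner_eval hornerM hornerC hornerXn xt exprS.
    by rewrite mulrC mulrCA mulrA.
  rewrite -mulrA [perturbed _ _ * _]mulrC ha //.
  rewrite (reindex (fun i : 'I_#|B| => enum_val i)) /=.
    by apply: eq_bigr => i _; rewrite !mxE mulrC.
  exact/onW_bij/enum_val_bij.
(* The monomial [1] is among the coordinates, so the eigenvector is nonzero. *)
pose b0 : B := [ffun=> Ordinal e_gt0].
apply/eqP => /rowP /(_ (enum_rank b0)) /eqP.
rewrite !mxE enum_rankK /mono big1 ?oner_eq0 // => i _.
by rewrite !ffunE expr0.
Qed.

End CriticalPoints.

(** * Large roots of a bivariate polynomial *)

Section LargeRoots.
Variable R : realFieldType.

(** Up to sign the leading coefficient is positive, and it then serves as [eps]. *)
Lemma poly_eventually_ge (p : {poly R}) : p != 0 ->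
  exists S, exists2 eps, 0 < eps & forall t, S <= t -> eps <= `|p.[t]|.
Proof.
move=> p0; wlog lp : p p0 / 0 < lead_coef p => [hw|].
  have [lp|lp|lp] := ltgtP 0 (lead_coef p).
  - exact: hw.
  - have [||S [eps eps0 hS]] := hw (- p); rewrite ?oppr_eq0 //.
      by rewrite lead_coefN oppr_gt0.
    by exists S, eps => // t /hS; rewrite hornerN normrN.
  - by move: p0; rewrite -lead_coef_eq0 -lp eqxx.
have [S hS] := poly_pinfty_gt_lc lp.
by exists S, (lead_coef p) => // t /hS h; rewrite (le_trans h) ?ler_norm.
Qed.

Lemma horner_le_pow (p : {poly R}) N t : (size p <= N.+1)%N -> 1 <= t ->
  `|p.[t]| <= (\sum_(j < N.+1) `|p`_j|) * t ^+ N.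
Proof.
move=> pN t1; have t0 : 0 <= t by rewrite (le_trans ler01).
rewrite (horner_coef_wide _ pN) mulr_suml (le_trans (ler_norm_sum _ _ _)) //.
apply: ler_sum => j _; rewrite normrM normrX (ger0_norm t0) ler_wpM2l //.
by rewrite ler_weXn2l // -ltnS.
Qed.

(* After swapping the variables and dividing by a power of [d], the constant
   term [q0] in [d] is a nonzero polynomial in [t], which stays away from [0]
   for large [t], whereas the remaining terms are [O(d * t ^+ N)]. *)
Lemma large_root_bound (P : {poly {poly R}}) N :
  P != 0 -> (size P <= N.+1)%N -> exists S K : R, [/\ 1 <= S, 0 < K &
    forall d t, 0 < d <= 1 -> S <= t -> P.[t, d] = 0 -> 1 <= K * d * t ^+ N].
Proof.
move=> P0 PN.
have [v [q qv Pq]] := multiplicity_XsubC (swapXY P) 0.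
move: qv; rewrite swapXY_eq0 P0 /= => q00.
have qN i : (size (q`_i)%R <= N.+1)%N.
  have -> : q`_i = (swapXY P)`_(i + v).
    by rewrite Pq polyC0 subr0 coefMXn ltnNge leq_addl addnK.
  apply/leq_sizeP => j Nj; rewrite coef_swapXY.
  by rewrite [P`_j]nth_default ?coef0 // (leq_trans PN).
rewrite rootE horner_coef0 in q00.
have [S [eps eps0 hS]] := poly_eventually_ge q00.
(* The range has one index more than [q] has coefficients, so that [big_ord_recl] can split off the
   constant term. *)
pose L := \sum_(i < (size q).+1) \sum_(j < N.+1) `|q`_i`_j|.
have L0 : 0 <= L by do 2![apply: sumr_ge0 => ? _].
(* [L + 1] keeps [K] positive even if [L = 0]. *)
exists (Num.max 1 S), ((L + 1) / eps); split.
- by rewrite le_max lexx.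
- by rewrite divr_gt0 // ltr_wpDl.
move=> d t /andP [d0 d1]; rewrite ge_max => /andP [t1 St] Pt.
have tN : 0 <= t ^+ N by rewrite exprn_ge0 // (le_trans ler01).
have qdt : q.[d, t] = 0.
  move: Pt; rewrite -horner2_swapXY Pq polyC0 subr0 hornerM hornerXn hornerM.
  move/eqP; rewrite mulf_eq0 => /orP [/eqP //|].
  by rewrite -rmorphXn hornerC expf_eq0 (gt_eqF d0) andbF.
have q0t : `|(q`_0).[t]| <= L * d * t ^+ N.
  move: qdt; rewrite [q.[_]](horner_coef_wide _ (leqnSn _)) big_ord_recl.
  rewrite expr0 mulr1 hornerD => /eqP.
  rewrite addr_eq0 => /eqP ->; rewrite normrN horner_sum.
  rewrite (le_trans (ler_norm_sum _ _ _)) // /L big_ord_recl mulrDl mulrDl.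
  rewrite -[X in X <= _]add0r lerD //.
    by rewrite !mulr_ge0 ?sumr_ge0 // ltW.
  rewrite !mulr_suml; apply: ler_sum => i _.
  rewrite -rmorphXn hornerM hornerC normrM mulrAC ler_pM //.
    exact: horner_le_pow.
  rewrite ger0_norm ?exprn_ge0 ?(ltW d0) //.
  by rewrite exprS ler_piMr ?(ltW d0) // exprn_ile1 ?(ltW d0).
have := le_trans (hS _ St) q0t => epsL.
rewrite -(ler_pM2l eps0) mulr1 (le_trans epsL) //.
have -> : eps * ((L + 1) / eps * d * t ^+ N) = (L + 1) * d * t ^+ N.
  by field; rewrite gt_eqF.
by rewrite !ler_wpM2r ?(ltW d0) // lerDl.
Qed.

End LargeRoots.

From mathcomp Require Import boolp classical_sets topology normedtype derive.
Import numFieldNormedType.Exports.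
Local Open Scope classical_set_scope.

(** * Existence of minimisers and vanishing of the gradient *)

Section Minimizers.
Variables (R : realType) (n : nat).
Implicit Types (x : 'I_n -> R) (s : seq (R * {ffun 'I_n -> nat})).

(** Points become row vectors here to obtain compact boxes from [rV_compact]. *)
Lemma continuous_coord_exp i k :
  continuous (fun v : 'rV[R]_n => v ord0 i ^+ k).
Proof.
have -> : (fun v : 'rV[R]_n => v ord0 i ^+ k) =
          horner 'X^k \o (fun v : 'rV[R]_n => v ord0 i).
  by apply/funext => v; rewrite /= hornerXn.
by move=> v; apply: continuous_comp; [exact: coord_continuous|
  exact: continuous_horner].
Qed.

Lemma continuous_peval s : continuous (fun v : 'rV[R]_n => peval s (v ord0)).
Proof.
apply: continuous_big => [|u _]; first exact: add_continuous.
move=> v.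
apply: (@continuousM _ _ (fun=> u.1) (fun w : 'rV[R]_n => mono u.2 (w ord0)) v).
  exact: cst_continuous.
move: v; apply: continuous_big => [|i _]; first exact: mul_continuous.
exact: continuous_coord_exp.
Qed.

Lemma continuous_perturbed e s d :
  continuous (fun v : 'rV[R]_n => perturbed e s d (v ord0)).
Proof.
move=> v; apply: (@continuousD _ _ _ (fun w : 'rV[R]_n => peval s (w ord0))
  (fun w : 'rV[R]_n => d * \sum_i w ord0 i ^+ e.+1)).
  exact: continuous_peval.
apply: (@continuousM _ _ (fun=> d)
  (fun w : 'rV[R]_n => \sum_i w ord0 i ^+ e.+1)).
  exact: cst_continuous.
move: v; apply: continuous_big => [|i _]; first exact: add_continuous.
exact: continuous_coord_exp.
Qed.

Lemma box_min (G : ('I_n -> R) -> R) r : 0 <= r ->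
  continuous (fun v : 'rV[R]_n => G (v ord0)) ->
  exists2 c, (forall i, `|c i| <= r) &
    forall x, (forall i, `|x i| <= r) -> G c <= G x.
Proof.
move=> r0 Gc; pose A := [set v : 'rV[R]_n | forall i, `[- r, r] (v ord0 i)].
have inA v : A v <-> forall i, `|v ord0 i| <= r.
  by split=> Av i; move: (Av i); rewrite /= in_itv /= ler_norml.
have A0 : A !=set0 by exists 0; apply/inA => i; rewrite mxE normr0.
have cA : compact A.
  by apply: (@rV_compact R n (fun=> `[- r, r])) => i; exact: segment_compact.
have [c /set_mem /inA cr cmin] :=
  compact_EVT_min A0 cA (continuous_subspaceT Gc).
exists (c ord0) => // x xr.
have xE : (\row_i x i) ord0 = x by apply/funext => i; rewrite mxE.
by rewrite -xE; apply: cmin; apply/mem_set/inA => i; rewrite mxE.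
Qed.

Lemma deriv_at_min (p : {poly R}) a :
  (forall t, p.[a] <= p.[t]) -> p^`().[a] = 0.
Proof.
move=> amin; have h : is_derive a (1 : R) (horner p) 0.
  apply: (@derive1_at_min R (horner p) (a - 1) (a + 1)) => [|t _||t _].
  - by lra.
  - exact: derivable_horner.
  - by rewrite in_itv /=; lra.
  - exact: amin.
by rewrite derivE derive1E; exact: derive_val.
Qed.

Lemma perturbed_update e s d x i t :
  perturbed e s d (update x i t) =
  (line_poly s x i + d *: 'X^(e.+1) +
     (d * \sum_(j | j != i) x j ^+ e.+1)%:P).[t].
Proof.
rewrite !hornerE horner_line_poly /perturbed -addrA (bigD1 i) //= /update eqxx.
rewrite mulrDr; congr (_ + (_ + d * _)).
by apply: eq_bigr => j /negPf ->.
Qed.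

(** The restriction to each coordinate line through [x] is a univariate polynomial with a minimum at
    [x i]. *)
Lemma minimizer_critical e s d x :
  (forall y, perturbed e s d x <= perturbed e s d y) -> critical e s d x.
Proof.
move=> xmin i.
pose p := line_poly s x i + d *: 'X^(e.+1) +
     (d * \sum_(j | j != i) x j ^+ e.+1)%:P.
have xE : update x i (x i) = x.
  by apply/funext => j; rewrite /update; case: eqP => // ->.
have : p^`().[x i] = 0.
  apply: deriv_at_min => t; rewrite -!perturbed_update xE; exact: xmin.
rewrite /p !derivD derivC addr0 hornerD horner_deriv_line_poly derivZ derivXn.
rewrite hornerZ hornerMn hornerXn /= => /eqP; rewrite addrC addr_eq0 => /eqP <-.
by rewrite -(mulr_natl _ e.+1); ring.
Qed.

(** Since [e.+1] is even and [r >= 1], outside the box of radius [r] the value is at least [d * r],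
    hence at least the value at [0]. A minimum over the box is therefore global. *)
Lemma exists_minimizer e s d : odd e -> (forall x, 0 <= peval s x) -> 0 < d ->
  exists x, forall y, perturbed e s d x <= perturbed e s d y.
Proof.
move=> odd_e s0 d0; pose G := perturbed e s d.
have pow0 (t : R) : 0 <= t ^+ e.+1 by rewrite exprn_even_ge0 //= odd_e.
have G0 x : 0 <= G x.
  by rewrite addr_ge0 ?mulr_ge0 ?(ltW d0) // sumr_ge0.
pose r := Num.max 1 (G (fun=> 0) / d).
have r1 : 1 <= r by rewrite le_max lexx.
have r0 : 0 <= r by rewrite (le_trans ler01).
have [c cr cmin] := box_min r0 (@continuous_perturbed e s d).
exists c => y.
have [/forallP yr|/forallPn [i]] := boolP [forall i, `|y i| <= r].
  exact: cmin.
rewrite -ltNge => ry; apply: (@le_trans _ _ (G (fun=> 0))).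
  by apply: cmin => j; rewrite normr0.
apply: (@le_trans _ _ (d * r)).
  by rewrite mulrC -ler_pdivrMr // le_max lexx orbT.
rewrite ler_wpDl // ler_wpM2l ?(ltW d0) //.
rewrite (bigD1 i) //= ler_wpDr ?sumr_ge0 //.
rewrite -[y i ^+ _]ger0_norm // normrX (le_trans (ltW ry)) //.
by rewrite ler_eXnr // (le_trans r1) // ltW.
Qed.

End Minimizers.

(** * Lower bounds by powers of [y] *)

Section LowerBounds.
Variables (R : realType) (n : nat).
Implicit Types (x : 'I_n -> R) (s : seq (R * {ffun 'I_n -> nat})).

(** A strong negation of the sentence with small [y]: below [z], no [y] admits an approximate
    zero. *)
Definition eventually_ge_pow s C : Prop :=
  exists2 z : R, 0 < z & forall y x, 0 < y < z ->
    (forall j, `|y * x j| < 1) -> y ^+ C <= `|peval s x|.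

Lemma bounded_away_eventually_ge_pow s C eta : (0 < C)%N -> 0 < eta ->
  (forall x, eta <= `|peval s x|) -> eventually_ge_pow s C.
Proof.
move=> C0 eta0 etaP; exists (Num.min 1 eta); first by rewrite lt_min ltr01.
move=> y x; rewrite lt_min => /and3P [y0 y1 yeta] _.
rewrite (le_trans _ (etaP x)) // (le_trans _ (ltW yeta)) //.
by rewrite -(prednK C0) exprS ler_piMr ?exprn_ile1 ?ltW.
Qed.

(* With [d = y ^+ (e.+1 * e ^ n).+1] the minimum of [perturbed d] is at most
   [(n + 1) * d / y ^+ e.+1], too small for [large_root_bound]. *)
Lemma nonvanishing_eventually_ge_pow s k e C :
  {in s, forall u : R * {ffun 'I_n -> nat}, (totdeg u.2 <= k)%N} ->
  odd e -> (k + k < e)%N -> (e.+1 * e ^ n < C)%N ->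
  (forall x, peval s x != 0) -> eventually_ge_pow s C.
Proof.
move=> sk odd_e ke eC s_neq0; pose q := psquare s; pose N := (e ^ n)%N.
have e_gt0 : (0 < e)%N by exact: leq_ltn_trans ke.
have q_gt0 x : 0 < peval q x.
  by rewrite peval_square lt_def sqr_ge0 expf_neq0.
have deg_q : {in q, forall u, (totdeg u.2 < e)%N}.
  by move=> u /(totdeg_square sk) uk; exact: leq_ltn_trans ke.
have [P [P0 PN Pq]] := critical_value_algebraic deg_q e_gt0.
have [S [K [S1 K0 SK]]] := large_root_bound P0 PN.
have S0 : 0 < S by rewrite (lt_le_trans ltr01).
have [c cS cmin] := box_min (ltW S0) (@continuous_peval R n q).
pose M : R := K * n.+1%:R ^+ N.
have M0 : 0 < M by rewrite mulr_gt0 // exprn_gt0 // ltr0n.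
(* The second bound will force [t >= S]; the third gives the final contradiction [M * y < 1]. *)
exists (Num.min 1 (Num.min (peval q c / S) M^-1)).
  by rewrite !lt_min ltr01 divr_gt0 ?invr_gt0.
move=> y x; rewrite !lt_min => /andP [y0 /and3P [y1 yS yM]] xy.
rewrite leNgt; apply/negP => sx.
pose d := y ^+ (e.+1 * N).+1.
have d0 : 0 < d by rewrite exprn_gt0.
have dy : d <= y.
  by rewrite /d exprS ler_piMr ?exprn_ile1 ?ltW.
have d1 : d <= 1 by rewrite (le_trans dy) // ltW.
have [x0 x0min] := exists_minimizer odd_e (fun x => ltW (q_gt0 x)) d0.
have [t dt] : exists t, perturbed e q d x0 = d * t.
  by exists (perturbed e q d x0 / d); rewrite mulrC divfK // gt_eqF.
have pow0 (a : R) : 0 <= a ^+ e.+1 by rewrite exprn_even_ge0 //= odd_e.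
(* If [t < S], the minimiser lies in the box of radius [S], so
   [peval q c <= peval q x0 <= d * t < y * S], against the choice of [y]. *)
have tS : S <= t.
  rewrite leNgt; apply/negP => tS.
  have sum_t : \sum_i x0 i ^+ e.+1 <= t.
    by rewrite -(ler_pM2l d0) -dt lerDr ltW.
  have x0S i : `|x0 i| <= S.
    rewrite leNgt; apply/negP => Sx.
    have : x0 i ^+ e.+1 <= t.
      by apply: le_trans sum_t; rewrite (bigD1 i) //= lerDl sumr_ge0.
    rewrite -[x0 i ^+ _]ger0_norm // normrX => xt.
    have : `|x0 i| <= `|x0 i| ^+ e.+1.
      by rewrite ler_eXnr // (le_trans S1) // ltW.
    by move=> /le_trans /(_ xt) /le_lt_trans /(_ tS); rewrite ltNge ltW.
  have q_le : peval q x0 <= d * t.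
    by rewrite -dt lerDl mulr_ge0 ?sumr_ge0 // ltW.
  have : d * t < y * S.
    rewrite (@le_lt_trans _ _ (y * t)) ?ltr_pM2l // ler_wpM2r //.
    by rewrite (le_trans _ sum_t) // sumr_ge0.
  move: yS; rewrite ltr_pdivlMr // => yS /lt_trans /(_ yS).
  by rewrite ltNge (le_trans (cmin _ x0S)).
have t0 : 0 <= t by rewrite (le_trans _ tS) // ltW.
have := SK d t; rewrite d0 d1 => /(_ isT tS (Pq _ _ _ _ dt)) => Kdt.
(* Compare the minimum with the value at [x], where each [(y * x i) ^+ e.+1] is at most [1] and
   [peval q x <= d]. *)
have yt : y ^+ e.+1 * t <= n.+1%:R.
  rewrite -(ler_pM2l d0) mulrCA -dt.
  have dy0 : 0 <= y ^+ e.+1 by rewrite exprn_ge0 // ltW.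
  apply: (le_trans (ler_wpM2l dy0 (x0min x))).
  rewrite /perturbed mulrDr -natr1 addrC mulrDr; apply: lerD.
    rewrite mulrCA ler_wpM2l ?(ltW d0) // mulr_sumr.
    rewrite -[n in n%:R]card_ord -sum1_card natr_sum; apply: ler_sum => i _.
    rewrite -exprMn -[_ ^+ _]ger0_norm // normrX exprn_ile1 //.
    by rewrite ltW.
  rewrite mulr1 -[d]mul1r ler_pM //; first exact: ltW.
    by rewrite exprn_ile1 ?ltW.
  have yC : y ^+ C <= d by rewrite ler_wiXn2l // !ltW.
  rewrite peval_square -[_ ^+ 2]ger0_norm ?sqr_ge0 // normrX expr2 -[d]mul1r.
  by rewrite ler_pM // ltW // (lt_le_trans sx) // (le_trans yC).
suff : 1 <= M * y by rewrite leNgt mulrC -ltr_pdivlMr // div1r yM.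
rewrite (le_trans (Kdt _)) //; first exact: minimizer_critical.
rewrite -[K * d * _]mulrA.
(* The exponent of [d] was chosen for this identity: one factor [y] is left over to beat [M]. *)
have -> : d * t ^+ N = y * (y ^+ e.+1 * t) ^+ N.
  by rewrite /d exprS exprM exprMn mulrA.
rewrite /M -!mulrA ler_pM2l // mulrC ler_wpM2r ?(ltW y0) //.
by rewrite lerXn2r ?nnegrE ?ler0n // mulr_ge0 // exprn_ge0 // ltW.
Qed.

(** Along a coordinate line the function is affine without zeros, hence constant. Setting the
    coordinates to [0] one at a time shows that it is constant everywhere. *)
Lemma multiaffine_eventually_ge_pow s C : (0 < C)%N ->
  {in s, forall (u : R * {ffun 'I_n -> nat}), forall i, (u.2 i <= 1)%N} ->
  (forall x, peval s x != 0) -> eventually_ge_pow s C.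
Proof.
move=> C0 s1 s_neq0.
have update_const x i t : peval s (update x i t) = peval s (update x i 0).
  set p := line_poly s x i; rewrite -!horner_line_poly -/p.
  have p2 : (size p <= 2)%N by apply: size_line_poly => u us; exact: s1.
  have pE r : p.[r] = p`_0 + p`_1 * r.
    by rewrite (horner_coef_wide _ p2) !big_ord_recl big_ord0 expr0 mulr1 addr0.
  suff p10 : p`_1 = 0 by rewrite !pE p10 !mul0r.
  apply/eqP/negP => /negP p1; have := s_neq0 (update x i (- p`_0 / p`_1)).
  by rewrite -horner_line_poly -/p pE mulrC divfK // subrr eqxx.
pose trunc x (k : nat) (j : 'I_n) : R := if (j < k)%N then x j else 0.
have peval_trunc x k : (k <= n)%N -> peval s (trunc x k) = peval s (fun=> 0).
  elim: k => [|k IH] kn //.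
  have -> : trunc x k.+1 = update (trunc x k) (Ordinal kn) (x (Ordinal kn)).
    apply/funext => j; rewrite /trunc /update ltnS leq_eqVlt -val_eqE /=.
    by case: eqP => // jk; congr x; apply: val_inj.
  rewrite update_const -IH ?(ltnW kn) //; apply: eq_peval => j.
  rewrite /update /trunc -val_eqE /=; case: eqP => // ->.
  by rewrite ltnn.
apply: (@bounded_away_eventually_ge_pow s C `|peval s (fun=> 0)|) => //.
  by rewrite normr_gt0.
move=> x; rewrite -(peval_trunc x n) // (@eq_peval _ _ s (trunc x n) x) //.
by move=> j; rewrite /trunc ltn_ord.
Qed.

End LowerBounds.

(** The leading terms of [p] and [p \Po - 'X] control the two ends of the line, compactness the
    middle. *)
Lemma rootfree_poly_bounded_away (R : realType) (p : {poly R}) :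
  (forall t, p.[t] != 0) -> exists2 eta, 0 < eta & forall t, eta <= `|p.[t]|.
Proof.
move=> p_neq0.
have p0 : p != 0 by apply: contraNneq (p_neq0 0) => ->; rewrite horner0.
have pm0 : p \Po - 'X != 0.
  apply: contraNneq (p_neq0 0) => /(congr1 (fun q : {poly R} => q.[0])).
  by rewrite horner_comp !hornerE oppr0 => ->.
have [S1 [e1 e1_gt0 h1]] := poly_eventually_ge p0.
have [S2 [e2 e2_gt0 h2]] := poly_eventually_ge pm0.
pose S := Num.max 0 (Num.max S1 S2).
have S0 : - S <= S by rewrite ge0_cp // le_max lexx.
(* The square replaces the absolute value because it is again a polynomial. *)
have [c _ cmin] := EVT_min S0
  (continuous_subspaceT (@continuous_horner R (p ^+ 2))).
exists (Num.min `|p.[c]| (Num.min e1 e2)).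
  by rewrite !lt_min normr_gt0 p_neq0 e1_gt0.
move=> t; rewrite !ge_min.
have [tS|St] := leP t (- S).
  have /h2 : S2 <= - t.
    by rewrite lerNr (le_trans tS) // lerN2 !le_max lexx !orbT.
  by rewrite horner_comp hornerN hornerX opprK => ->; rewrite !orbT.
have [St'|tS] := leP S t.
  by rewrite h1 ?orbT // (le_trans _ St') // !le_max lexx !orbT.
have /cmin : t \in `[- S, S]%R by rewrite in_itv /= !ltW.
by rewrite !horner_exp -ler_sqrt ?sqr_ge0 // !sqrtr_sqr => ->.
Qed.

(** This is the source of [c = 4]. Since [2 <= D], [e.+1 <= D * (2n + 1) <= D ^ n.+2], so the
    product is below [D ^ (n.+2 * n.+1)], and both [n.+1] and [n.+2] are at most [n ^ 2]. *)
Lemma degree_exponent_bound n D : (1 < n)%N -> (1 < D)%N ->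
  ((n * D).*2.+2 * (n * D).*2.+1 ^ n < D ^ (n ^ 4))%N.
Proof.
move=> n1 D1; set e := (n * D).*2.+1; have n0 := ltnW n1.
have eD : (e.+1 <= D ^ n.+2)%N.
  have n2 : (n.*2.+1 < 2 ^ n.+1)%N.
    case: n n1 {e n0} => [|[|k _]] //; elim: k => [|k IH] //.
    by rewrite expnS; lia.
  have : (2 ^ n.+1 <= D ^ n.+1)%N by rewrite leq_exp2r.
  move=> /(leq_trans (ltnW n2)) nD.
  apply: (@leq_trans (D * n.*2.+1)); first by rewrite /e; nia.
  by rewrite expnS leq_mul2l nD orbT.
apply: (@leq_trans (e.+1 ^ n.+1)).
  by rewrite expnS ltn_pmul2l // ltn_exp2r.
apply: (@leq_trans (D ^ (n.+2 * n.+1))); first by rewrite expnM leq_exp2r.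
rewrite leq_exp2l // (expnM n 2 2) expnS expn1 leq_mul //.
  by rewrite -mulnn; nia.
by rewrite -mulnn; nia.
Qed.

(** * Combination of the cases and the equivalence *)

Lemma rootfree_eventually_ge_pow (R : realType) n D
    (s : seq (R * {ffun 'I_n -> nat})) :
  (0 < n)%N -> (0 < D)%N ->
  {in s, forall (u : R * {ffun 'I_n -> nat}), forall i, (u.2 i <= D)%N} ->
  (forall x, peval s x != 0) ->
  eventually_ge_pow s (n * D ^ (n ^ 4) + D.+1 * n).
Proof.
move=> n0 D0 sD s_neq0; set C := addn _ _.
have C0 : (0 < C)%N by rewrite addn_gt0 orbC muln_gt0 n0.
have [D1|D1] := leqP D 1.
  apply: multiaffine_eventually_ge_pow => // u us i.
  exact: leq_trans (sD u us i) D1.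
have [n1|n1] := leqP n 1.
  have {n1} n1 : n = 1%N by apply/eqP; rewrite eqn_leq n1.
  subst n; pose p := line_poly s (fun=> 0) ord0.
  have pE x : peval s x = p.[x ord0].
    rewrite horner_line_poly; apply: eq_peval => j.
    by rewrite /update !ord1 eqxx.
  have [|eta eta0 etaP] := @rootfree_poly_bounded_away R p.
    by move=> t; rewrite -(pE (fun=> t)).
  apply: (bounded_away_eventually_ge_pow C0 eta0) => x.
  by rewrite pE.
(* The total degree is at most [n * D], that of the square at most twice this, and [e] is the next
   odd number. *)
apply: (@nonvanishing_eventually_ge_pow _ _ s (n * D) (n * D).*2.+1) => //.
- by move=> u us; apply: totdeg_le => i; exact: sD.
- by rewrite /= odd_double.
- by rewrite addnn.
rewrite (leq_trans (degree_exponent_bound n1 D1)) // /C.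
by rewrite (leq_trans _ (leq_addr _ _)) // leq_pmull.
Qed.

Theorem theorem7 (R : realType) :
  exists c : nat, (0 < c)%N /\
  forall (n D : nat) (f : mpoly.mpoly n R),
    (0 < n)%N -> (0 < D)%N -> mdeg_each_le D f ->
    let C := (n * D ^ (n ^ c) + D.+1 * n)%N in
    (exists x : 'I_n -> R, mpoly.meval x f = 0)
    <->
    (forall z : R, 0 < z ->
     exists y : R, 0 < y < z /\
     exists x : 'I_n -> R,
       `|mpoly.meval x f| < y ^+ C /\ forall j : 'I_n, `|y * x j| < 1).
Proof.
exists 4%N; split => // n D f n0 D0 fD C; split=> [[x fx] z z0|fsmall].
  (* [T] exceeds the absolute value of every coordinate, so [y <= T^-1] suffices for the box
     condition. *)
  pose T := 1 + \sum_i `|x i|.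
  have T0 : 0 < T by rewrite ltr_pwDl // sumr_ge0.
  pose y := Num.min (z / 2) (T^-1).
  have y0 : 0 < y by rewrite lt_min invr_gt0 T0 divr_gt0.
  exists y; split.
    by rewrite y0 gt_min ltr_pdivrMr // ltr_pMr // ltr1n.
  exists x; split=> [|j]; first by rewrite fx normr0 exprn_gt0.
  rewrite normrM gtr0_norm //; apply: (@le_lt_trans _ _ (T^-1 * `|x j|)).
    by rewrite ler_wpM2r // ge_min lexx orbT.
  rewrite mulrC ltr_pdivrMr // mul1r ltr_pwDl //.
  by rewrite (bigD1 j) //= lerDl sumr_ge0.
have [s sD sE] := meval_peval fD.
apply: contrapT => /forallNP f_neq0.
have s_neq0 x : peval s x != 0 by rewrite -sE; apply/eqP.
have [z z0 hz] := rootfree_eventually_ge_pow n0 D0 sD s_neq0.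
have [y [yz [x [fx xy]]]] := fsmall z z0.
by have := hz y x yz xy; rewrite -sE leNgt fx.
Qed.
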